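(* Let $n\ge2$, $\ell=\ell(n)$, and let $I\subseteq\{1,2\}^{\ell}$ with $\operatorname{card}(I)=n-2^{\ell}$. Then $\alpha_n(I)$ is a constrained optimal set of $n$-points for $P$, and the $n$th constrained quantization error is \[V_n=V(P;\alpha_n(I))=\frac{1}{18^{\ell}}\cdot\frac18\Big(2^{\ell+1}-n+\frac19(n-2^{\ell})\Big)+A(n,I),\] where the first summand equals the $n$th unconstrained quantization error $V(P;U_n(\alpha_n(I)))$ of $P$.
   Context: $P$ is the Cantor distribution on $\mathbb R$: the unique Borel probability measure with $P=\frac12P\circ T_1^{-1}+\frac12 P\circ T_2^{-1}$, where $T_1(x)=\frac x3$, $T_2(x)=\frac x3+\frac23$. Points $x\in\mathbb R$ are identified with $(x,0)\in\mathbb R^2$. For $j\in\mathbb N$, $S_j=\{(x,y):-\frac1j\le x\le1,\ y=x+\frac1j\}$. For finite $\alpha\subset\mathbb R^2$, $V(P;\alpha)=\int\min_{(p,q)\in\alpha}\big((x-p)^2+q^2\big)\,dP(x)$; the $n$th constrained quantization error is $V_n=\inf\{V(P;\alpha):\alpha\subseteq\bigcup_{j=1}^nS_j,\ 1\le\operatorname{card}(\alpha)\le n\}$, and a constrained optimal set of $n$-points is a set attaining it. Let $\rho(x,(p,q))=(x-p)^2+q^2$. For $\sigma=\sigma_1\cdots\sigma_k\in\{1,2\}^k$, $T_\sigma=T_{\sigma_1}\circ\cdots\circ T_{\sigma_k}$, $a(\sigma)=T_\sigma(\frac12)$; $\sigma1,\sigma2$ are concatenations. $U_n:S_n\to\mathbb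 R$, $U_n(x,x+\frac1n)=2x+\frac1n$, with inverse $U_n^{-1}(u)=\big(\frac12(u-\frac1n),\frac12(u-\frac1n)+\frac1n\big)$. For $n\ge2$, $\ell(n)$ is the unique natural number with $2^{\ell(n)}\le n<2^{\ell(n)+1}$, and for $I\subseteq\{1,2\}^{\ell(n)}$ with $\operatorname{card}(I)=n-2^{\ell(n)}$, \[\alpha_n(I)=\{U_n^{-1}(a(\sigma)):\sigma\in\{1,2\}^{\ell(n)}\setminus I\}\cup\{U_n^{-1}(a(\sigma1)):\sigma\in I\}\cup\{U_n^{-1}(a(\sigma2)):\sigma\in I\}\subseteq S_n,\] \[A(n,I)=\sum_{\sigma\in\{1,2\}^{\ell(n)}\setminus I}\frac{1}{2^{\ell(n)}}\rho\big(a(\sigma),U_n^{-1}(a(\sigma))\big)+\sum_{\sigma\in I}\frac{1}{2^{\ell(n)+1}}\Big(\rho\big(a(\sigma1),U_n^{-1}(a(\sigma1))\big)+\rho\big(a(\sigma2),U_n^{-1}(a(\sigma2))\big)\Big).\] *)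

(* Defs.v *)
From HB Require Import structures.
From mathcomp Require Import all_boot all_order all_algebra finmap.
From mathcomp Require Import all_classical all_reals all_analysis.
Set Implicit Arguments. Unset Strict Implicit. Unset Printing Implicit Defensive.
Import Order.TTheory GRing.Theory Num.Theory.
Local Open Scope classical_set_scope.
Local Open Scope ring_scope.


Section Defs.
Variable R : realType.

(* The two similarity maps. Letter false = 1, true = 2. *)
Definition T1 (x : R) : R := x / 3.
Definition T2 (x : R) : R := x / 3 + 2 / 3.
Definition Tb (b : bool) : R -> R := if b then T2 else T1.

Definition Tword (s : seq bool) (x : R) : R := foldr (fun b y => Tb b y) x s.
Definition aw (s : seq bool) : R := Tword s (1 / 2).

Definition rho (x : R) (a : R * R) : R := (x - (fst a)) ^+ 2 + (snd a) ^+ 2.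

Definition Sj (j : nat) : set (R * R) :=
  [set a : R * R | - (j%:R)^-1 <= (fst a) <= 1 /\ (snd a) = (fst a) + (j%:R)^-1].

Definition distE (x : R) (al : {fset (R * R)}) : \bar R :=
  \big[Order.min/+oo%E]_(a <- al) (rho x a)%:E.

Definition Vq (P : probability R R) (al : {fset (R * R)}) : \bar R :=
  (\int[P]_x distE x al)%E.

Definition admissible (n : nat) (al : {fset (R * R)}) : Prop :=
  [set` al] `<=` \bigcup_(j in [set j : nat | (1 <= j <= n)%N]) Sj j
  /\ (1 <= #|` al| <= n)%N.

Definition Vn (P : probability R R) (n : nat) : \bar R :=
  ereal_inf [set Vq P al | al in admissible n].

Definition constrained_optimal (P : probability R R) (n : nat)
  (al : {fset (R * R)}) : Prop :=
  admissible n al /\ Vq P al = Vn P n.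

Definition distLine (x : R) (be : {fset R}) : \bar R :=
  \big[Order.min/+oo%E]_(b <- be) ((x - b) ^+ 2)%:E.

Definition Vline (P : probability R R) (be : {fset R}) : \bar R :=
  (\int[P]_x distLine x be)%E.

Definition Vunc (P : probability R R) (n : nat) : \bar R :=
  ereal_inf [set Vline P be | be in
     [set be : {fset R} | (1 <= #|` be| <= n)%N]].

Definition Un (n : nat) (a : R * R) : R := 2 * (fst a) + (n%:R)^-1.
Definition Uninv (n : nat) (u : R) : R * R :=
  ((u - (n%:R)^-1) / 2, (u - (n%:R)^-1) / 2 + (n%:R)^-1).

Definition alpha_n (n l : nat) (I : {set l.-tuple bool}) : {fset (R * R)} :=
  ([fset Uninv n (aw (val s)) | s in enum (~: I)]
  `|` [fset Uninv n (aw (rcons (val s) false)) | s in enum I]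
  `|` [fset Uninv n (aw (rcons (val s) true)) | s in enum I])%fset.

Definition A_nI (n l : nat) (I : {set l.-tuple bool}) : R :=
  \sum_(s in ~: I) (2 ^+ l)^-1 * rho (aw (val s)) (Uninv n (aw (val s)))
  + \sum_(s in I) (2 ^+ l.+1)^-1 *
      (rho (aw (rcons (val s) false)) (Uninv n (aw (rcons (val s) false)))
       + rho (aw (rcons (val s) true)) (Uninv n (aw (rcons (val s) true)))).

Definition cantor_selfsimilar (P : probability R R) : Prop :=
  forall A : set R, measurable A ->
    P A = ((2^-1)%:E * P (T1 @^-1` A) + (2^-1)%:E * P (T2 @^-1` A))%E.

End Defs.
Arguments alpha_n {R} n {l} I.
Arguments A_nI {R} n {l} I.
Arguments Un {R} n a.

(* Main.v *)
Require Import Defs.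
From HB Require Import structures.
From mathcomp Require Import all_boot all_order all_algebra finmap.
From mathcomp Require Import all_classical all_reals all_analysis.
From mathcomp Require Import measurable_realfun ring lra zify.
Import Order.TTheory GRing.Theory Num.Theory.
Import numFieldNormedType.Exports.
Local Open Scope classical_set_scope.
Local Open Scope ring_scope.

(** For [a = (p, q)] one has [rho x a = ((x - (p + q))^2 + (x + (q - p))^2) / 2],
    and [q - p = 1/j] on [S_j]. On [[0, 1]] the second square is smallest for
    [j = n], so the constrained problem reduces to the unconstrained one for the
    points [p + q], and [V_n = (V_n^unc + \int (x + 1/n)^2 dP) / 2].

    The unconstrained error is the maximum over [l] of the affine functions
    [g_l(n) = 18^-l / 72 * (17 * 2^l - 8 n)], which satisfy
    [g_{l+1}(k + m) = (g_l(k) + g_l(m)) / 18]. The lower bound by every [g_l]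
    follows by induction on [l]: if no point of the codebook is nearest both to
    some point of [[0, 1/3]] and to some point of [[2/3, 1]], the codebook splits
    into two rescaled ones. Otherwise such a point [c], which may be assumed to
    satisfy [c >= 1/2], forces every other point to be at most [2/3 - c] or at
    least [4/3 - c], and the error on the cylinders of level 2 is already too
    large. *)

(** * Pointwise minima of finitely many cost functions *)

Section MinCost.
Context {R : realType} {T : eqType} (F : T -> R -> R).

(** The fold is seeded with the first entry, so the minimum stays in [R] and needs no infinite
    neutral element; 0 on the empty list is a default value. *)
Definition mincost (s : seq T) (x : R) : R :=
  if s is i0 :: s' then foldr (fun i m => Num.min (F i x) m) (F i0 x) s' else 0.

Lemma mincost_attained (s : seq T) (x : R) :
  s != [::] -> exists2 i, i \in s & mincost s x = F i x.
Proof.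
case: s => [//|i0 s _] /=; elim: s => [|j s [i si si_min]] /=.
  by exists i0; rewrite ?mem_head.
rewrite si_min minEle; case: ifP => _; first by exists j; rewrite // !inE eqxx orbT.
by exists i => //; move: si; rewrite !inE => /orP[->//|->]; rewrite !orbT.
Qed.

Lemma mincost_le (s : seq T) (i : T) (x : R) : i \in s -> mincost s x <= F i x.
Proof.
case: s => [//|i0 s] /=; elim: s => [|j s IHs] /=.
  by rewrite mem_seq1 => /eqP ->.
by rewrite ge_min !inE orbCA => /orP[/eqP ->|/IHs ->]; rewrite ?lexx ?orbT.
Qed.

Lemma mincost_ge (s : seq T) (m x : R) :
  s != [::] -> (forall i, i \in s -> m <= F i x) -> m <= mincost s x.
Proof. by move=> /(mincost_attained _ x)[i si ->]; exact. Qed.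

(** Passes from the extended-real minima in [distE] and [distLine] to a real, continuous
    integrand. *)
Lemma bigmin_mincost (s : seq T) (x : R) :
  s != [::] -> (\big[Order.min/+oo]_(i <- s) (F i x)%:E)%E = (mincost s x)%:E.
Proof.
move=> s0; apply/eqP; rewrite eq_le; apply/andP; split.
  have [i si ->] := mincost_attained _ x s0.
  exact: ge_bigmin_seq.
rewrite big_seq; elim/big_ind: _ => [|y z yE zE|i si]; first by rewrite leey.
  by rewrite le_min yE.
by rewrite lee_fin mincost_le.
Qed.

Lemma continuous_mincost (s : seq T) :
  (forall i, continuous (F i)) -> continuous (mincost s).
Proof.
move=> cF; case: s => [|i0 s] /=; first exact: cst_continuous.
elim: s => [|j s IHs] /= x; first exact: cF.
exact: (@continuous_min R R (F j) _ x (cF j x) (IHs x)).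
Qed.

End MinCost.

(** * Continuity of affine maps and their squares *)

Definition sqdist {R : realType} (b x : R) : R := (x - b) ^+ 2.

Lemma continuous_affine {R : realType} (p q : R) :
  continuous (fun x : R => p * x + q).
Proof.
move=> x; apply: cvgD; last exact: cvg_cst.
by apply: cvgM; [exact: cvg_cst|exact: cvg_id].
Qed.

Lemma continuous_affine_sqr {R : realType} (p q : R) :
  continuous (fun x : R => (p * x + q) ^+ 2).
Proof.
by move=> x; rewrite /GRing.exp /=; apply: cvgM; exact: continuous_affine.
Qed.

Lemma continuous_shift_sqr {R : realType} (q : R) :
  continuous (fun x : R => (x + q) ^+ 2).
Proof.
have -> : (fun x : R => (x + q) ^+ 2) = (fun x => (1 * x + q) ^+ 2).
  by apply/funext => x; rewrite mul1r.
exact: continuous_affine_sqr.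
Qed.

Lemma continuous_sqdist {R : realType} (b : R) : continuous (sqdist b).
Proof. exact: (@continuous_shift_sqr R (- b)). Qed.

Lemma continuous_Tb {R : realType} (i : bool) : continuous (@Tb R i).
Proof.
have -> : @Tb R i = (fun x => 3^-1 * x + (if i then 2 / 3 else 0)).
  by apply/funext => x; rewrite mulrC; case: i; rewrite //= addr0.
exact: continuous_affine.
Qed.

(* The functional [f |-> \int f dP] on continuous functions, for a self-similar
   [P], which is then carried by [0, 1]. *)
Record cantor_mean {R : realType} (E : (R -> R) -> R) : Prop := CantorMean {
  cantor_meanD : forall f g : R -> R, continuous f -> continuous g ->
    E (fun x => f x + g x) = E f + E g;
  cantor_meanZ : forall (k : R) (f : R -> R), continuous f ->
    E (fun x => k * f x) = k * E f;
  cantor_mean1 : E (fun=> 1) = 1;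
  cantor_mean_le : forall f g : R -> R, continuous f -> continuous g ->
    (forall x : R, 0 <= x <= 1 -> f x <= g x) -> E f <= E g;
  cantor_mean_self : forall f : R -> R, continuous f ->
    E f = 2^-1 * (E (f \o Tb false) + E (f \o Tb true)) }.

Arguments cantor_meanD {R E} _ [f g].
Arguments cantor_meanZ {R E} _ _ [f].
Arguments cantor_mean1 {R E} _.
Arguments cantor_mean_le {R E} _ [f g].
Arguments cantor_mean_self {R E} _ [f].

(** * Moments and symmetry of a self-similar mean *)

Section CantorMean.
Context {R : realType} {E : (R -> R) -> R} (HE : cantor_mean E).

Let continuous_comp2 (f g : R -> R) :
  continuous f -> continuous g -> continuous (f \o g).
Proof. by move=> cf cg x; apply: continuous_comp; [exact: cg|exact: cf]. Qed.

Let cst (k : R) : E (fun=> k) = k.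
Proof.
have -> : (fun=> k) = (fun=> k * 1) :> (R -> R) by apply/funext => x; rewrite mulr1.
by rewrite (cantor_meanZ HE) ?(cantor_mean1 HE) ?mulr1//; exact: cst_continuous.
Qed.

Lemma cantor_mean_affine (p q : R) : E (fun x => p * x + q) = p / 2 + q.
Proof.
have cid : continuous (fun x : R => x) by move=> x; exact: cvg_id.
have aff u v : E (fun x => u * x + v) = u * E id + v.
  rewrite (cantor_meanD HE) ?(cantor_meanZ HE) ?cst//.
    by move=> x; apply: cvgM; [exact: cvg_cst|exact: cvg_id].
  exact: cst_continuous.
have /eqP := cantor_mean_self HE cid.
have -> : id \o Tb false = (fun x : R => 3^-1 * x + 0).
  by apply/funext => x /=; rewrite mulrC addr0.
have -> : id \o Tb true = (fun x : R => 3^-1 * x + 2 / 3).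
  by apply/funext => x /=; rewrite mulrC.
(* Self-similarity gives the mean [m] the equation m = m/3 + 1/3. *)
rewrite !aff => /eqP E1; have : E id = 1 / 2 by lra.
by move=> ->; rewrite mul1r.
Qed.

Lemma cantor_mean_quadratic (a b c : R) :
  E (fun x => a * x ^+ 2 + (b * x + c)) = a * (3 / 8) + (b / 2 + c).
Proof.
have cid : continuous (fun x : R => x) by move=> x; exact: cvg_id.
have csq : continuous (fun x : R => x ^+ 2).
  by move=> x; rewrite /GRing.exp /=; apply: cvgM; exact: cvg_id.
have cZsq u : continuous (fun x : R => u * x ^+ 2).
  by move=> x; apply: cvgM; [exact: cvg_cst|exact: csq].
have quad u v w : E (fun x => u * x ^+ 2 + (v * x + w))
    = u * E (fun x => x ^+ 2) + (v / 2 + w).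
  rewrite (cantor_meanD HE) ?(cantor_meanZ HE) ?cantor_mean_affine//.
  exact: continuous_affine.
have /eqP := cantor_mean_self HE csq.
have -> : (fun x => x ^+ 2) \o Tb false = (fun x : R => 9^-1 * x ^+ 2 + (0 * x + 0)).
  by apply/funext => x /=; rewrite /T1; field.
have -> : (fun x => x ^+ 2) \o Tb true =
    (fun x : R => 9^-1 * x ^+ 2 + (4 / 9 * x + 4 / 9)).
  by apply/funext => x /=; rewrite /T2; field.
(* The second moment [t] satisfies t = t/9 + 1/3, hence t = 3/8. *)
rewrite !quad => /eqP E1; congr (_ * _ + _); lra.
Qed.

(** Variance plus squared mean: the mean is 1/2 and the variance 3/8 - 1/4 = 1/8. *)
Lemma cantor_mean_affine_sqr (p q : R) :
  E (fun x => (p * x + q) ^+ 2) = p ^+ 2 / 8 + (p / 2 + q) ^+ 2.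
Proof.
have -> : (fun x => (p * x + q) ^+ 2) =
    (fun x => p ^+ 2 * x ^+ 2 + (2 * p * q * x + q ^+ 2)).
  by apply/funext => x; ring.
by rewrite cantor_mean_quadratic; field.
Qed.

Lemma cantor_mean_ge0 (f : R -> R) : continuous f ->
  (forall x : R, 0 <= x <= 1 -> 0 <= f x) -> 0 <= E f.
Proof.
move=> cf f0; rewrite -(cst 0); apply: (cantor_mean_le HE) => //.
exact: cst_continuous.
Qed.

(** Every local lower bound on the quantization error is obtained from such a minorant, the square
    of an affine function. *)
Lemma cantor_mean_ge_sqr (f : R -> R) (p q : R) : continuous f ->
  (forall x : R, 0 <= x <= 1 -> (p * x + q) ^+ 2 <= f x) ->
  p ^+ 2 / 8 + (p / 2 + q) ^+ 2 <= E f.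
Proof.
move=> cf pqf; rewrite -cantor_mean_affine_sqr; apply: (cantor_mean_le HE) => //.
exact: continuous_affine_sqr.
Qed.

Lemma continuous_comp_Tb (f : R -> R) (i : bool) :
  continuous f -> continuous (f \o Tb i).
Proof. by move=> cf; apply: continuous_comp2 => //; exact: continuous_Tb. Qed.

Lemma cantor_mean_self2 (f : R -> R) : continuous f ->
  E f = 4^-1 * ((E (f \o Tb false \o Tb false) + E (f \o Tb false \o Tb true))
                + (E (f \o Tb true \o Tb false) + E (f \o Tb true \o Tb true))).
Proof.
move=> cf; rewrite (cantor_mean_self HE cf).
rewrite (cantor_mean_self HE (continuous_comp_Tb _ false cf)).
by rewrite (cantor_mean_self HE (continuous_comp_Tb _ true cf)); field.
Qed.

(** Reflection about 1/2 exchanges [T1] and [T2], so self-similarity survives with the two halves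
    swapped. *)
Lemma cantor_mean_reflect : cantor_mean (fun f => E (f \o (fun x => 1 - x))).
Proof.
have crefl : continuous (fun x : R => 1 - x).
  by move=> x; apply: cvgB; [exact: cvg_cst|exact: cvg_id].
split.
- by move=> f g cf cg; rewrite -(cantor_meanD HE) //; exact: continuous_comp2.
- by move=> k f cf; rewrite -(cantor_meanZ HE) //; exact: continuous_comp2.
- by rewrite -[RHS](cantor_mean1 HE).
- move=> f g cf cg fg; apply: (cantor_mean_le HE); try exact: continuous_comp2.
  by move=> x x01; apply: fg; lra.
- move=> f cf; rewrite (cantor_mean_self HE); last exact: continuous_comp2.
  rewrite addrC; congr (_ * (E _ + E _)); apply/funext => x /=; congr f;
    rewrite /T1 /T2; by field.
Qed.

End CantorMean.

(* The affine function of [n] that gives the error when [2^l <= n <= 2^(l+1)]. *)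
Definition quant_bound {R : realType} (l n : nat) : R :=
  (18 ^+ l)^-1 / 72 * (17 * 2 ^+ l - 8 * n%:R).

(** * Arithmetic of the affine bounds *)

Section QuantBound.
Context {R : realType}.

(** Only the total k + m enters on the left, so the induction need not know how the points are
    shared between the two halves. *)
Lemma quant_boundD (l k m : nat) :
  quant_bound l.+1 (k + m) = (quant_bound l k + quant_bound l m) / 18 :> R.
Proof. by rewrite /quant_bound natrD !exprS invfM; field; exact: expf_neq0. Qed.

Lemma quant_bound_anti (l m n : nat) : (m <= n)%N ->
  quant_bound l n <= quant_bound l m :> R.
Proof.
move=> mn; rewrite /quant_bound ler_wpM2l ?divr_ge0 ?invr_ge0 ?exprn_ge0//.
by rewrite lerD2l lerN2 ler_wpM2l// ler_nat.
Qed.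

(** Dropping the term in [n] leaves geometric decay in [l]; a bound uniform in [l] then needs only a
    few explicit levels. *)
Lemma quant_bound_le_expr (l n : nat) :
  quant_bound l n <= 17 / 72 * (9 ^+ l)^-1 :> R.
Proof.
apply: le_trans (quant_bound_anti l _ _ (leq0n n)) _.
rewrite /quant_bound mulr0 subr0 (_ : 18 = 9 * 2 :> R) ?exprMn; last by ring.
rewrite le_eqVlt; apply/orP; left; apply/eqP; field.
by rewrite !expf_neq0.
Qed.

Lemma quant_bound_le_expr2 (k l n : nat) : (k <= l)%N ->
  quant_bound l n <= 17 / 72 * (9 ^+ k)^-1 :> R.
Proof.
move=> kl; apply: le_trans (quant_bound_le_expr l n) _.
rewrite ler_wpM2l// lef_pV2 ?posrE ?exprn_gt0//.
by rewrite ler_weXn2l//; lra.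
Qed.

(** The constants 1/8, 1/72, 5/648 and 1/648 here and in the next three lemmas are the maxima over
    [l] of [quant_bound l n] at n = 1, 2, 3, 4. *)
Lemma quant_bound_le1 (l n : nat) : (1 <= n)%N -> quant_bound l n <= 8^-1 :> R.
Proof.
move=> n1; apply: le_trans (quant_bound_anti l _ _ n1) _.
case: l => [|l]; first by rewrite /quant_bound; lra.
by have := quant_bound_le_expr2 1 l.+1 1 isT; lra.
Qed.

Lemma quant_bound_le2 (l n : nat) : (2 <= n)%N -> quant_bound l n <= 72^-1 :> R.
Proof.
move=> n2; apply: le_trans (quant_bound_anti l _ _ n2) _.
case: l => [|[|l]]; [by rewrite /quant_bound; lra..|].
by have := quant_bound_le_expr2 2 l.+2 2 isT; lra.
Qed.

Lemma quant_bound_le3 (l n : nat) : (3 <= n)%N -> quant_bound l n <= 5 / 648 :> R.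
Proof.
move=> n3; apply: le_trans (quant_bound_anti l _ _ n3) _.
case: l => [|[|l]]; [by rewrite /quant_bound; lra..|].
by have := quant_bound_le_expr2 2 l.+2 3 isT; lra.
Qed.

Lemma quant_bound_le4 (l n : nat) : (4 <= n)%N -> quant_bound l n <= 648^-1 :> R.
Proof.
move=> n4; apply: le_trans (quant_bound_anti l _ _ n4) _.
case: l => [|[|[|l]]]; [by rewrite /quant_bound; lra..|].
by have := quant_bound_le_expr2 3 l.+3 4 isT; lra.
Qed.

End QuantBound.

Lemma ler_sqr_or {R : realType} (y z : R) :
  0 <= y -> (y <= z) \/ (y <= - z) -> y ^+ 2 <= z ^+ 2.
Proof. by move=> y0 [yz|yz]; nra. Qed.

(** * Codebooks with one point nearest to parts of both thirds *)

Section Straddle.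
Context {R : realType} {E : (R -> R) -> R} (HE : cantor_mean E).
Context (s : seq R) (c : R).
Hypotheses (cs : c \in s) (c_half : 1 / 2 <= c).
Hypothesis straddle : forall b, b \in s ->
  [\/ b = c, b < c /\ b <= 2 / 3 - c | c < b /\ 4 / 3 - c <= b].

Local Notation V := (mincost sqdist s).

Let s0 : s != [::].
Proof. by move: cs; case: (s). Qed.

Let cV : continuous V.
Proof. by apply: continuous_mincost => b; exact: continuous_sqdist. Qed.

Let V_ge0 x : 0 <= V x.
Proof. by apply: mincost_ge => // b _; exact: sqr_ge0. Qed.

(** [E (V \o Tb i \o Tb j)] is the mean error on one of the four cylinders of level 2, each of which
    has weight 1/4 in [E V]. *)
Let J_ge i j (p q : R) :
  (forall x b : R, 0 <= x <= 1 -> b \in s ->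
     (p * x + q) ^+ 2 <= sqdist b (Tb i (Tb j x))) ->
  p ^+ 2 / 8 + (p / 2 + q) ^+ 2 <= E (V \o Tb i \o Tb j).
Proof.
move=> pq; apply: (cantor_mean_ge_sqr HE).
  by do 2!apply: continuous_comp_Tb.
by move=> x x01; apply: mincost_ge => // b bs; exact: pq.
Qed.

Let J_ge0 i j : 0 <= E (V \o Tb i \o Tb j).
Proof.
by apply: (cantor_mean_ge0 HE) => [|x _]; [do 2!apply: continuous_comp_Tb|exact: V_ge0].
Qed.

Let half_ge i (p q : R) :
  (forall x b : R, 0 <= x <= 1 -> b \in s -> (p * x + q) ^+ 2 <= sqdist b (Tb i x)) ->
  p ^+ 2 / 8 + (p / 2 + q) ^+ 2 <= E (V \o Tb i).
Proof.
move=> pq; apply: (cantor_mean_ge_sqr HE); first exact: continuous_comp_Tb.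
by move=> x x01; apply: mincost_ge => // b bs; exact: pq.
Qed.

(* The codebook leaves the gap between [2/3 - c] and [c] empty, which is costly on
   [[2/9, 1/3]]. *)
Let J12_ge : (9^-1) ^+ 2 / 8 + (9^-1 / 2 + (c - 4 / 9)) ^+ 2
  <= E (V \o Tb false \o Tb true).
Proof.
have c2 := c_half; apply: J_ge => x b x01 /straddle bs; rewrite /sqdist /= /T1 /T2.
by apply: ler_sqr_or; [lra|case: bs => [->|[]|[]] *; [right|left|right]; lra].
Qed.

(** With every point at or beyond 1/2, the left third alone contributes at least 1/16. *)
Let straddle_right : (forall b, b \in s -> c <= b) -> 72^-1 <= E V.
Proof.
have c2 := c_half; move=> cb.
have J1 : (3^-1) ^+ 2 / 8 + (3^-1 / 2 - 1 / 2) ^+ 2 <= E (V \o Tb false).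
  apply: half_ge => x b x01 /cb bs; rewrite /sqdist /= /T1 -sqrrN.
  by apply: ler_sqr_or; [lra|right; lra].
have J2 : 0 <= E (V \o Tb true).
  by apply: (cantor_mean_ge0 HE) => // [|x _]; [exact: continuous_comp_Tb|exact: V_ge0].
rewrite (cantor_mean_self HE cV); lra.
Qed.

Let straddle_left : (forall b, b \in s -> b <= c) -> 72^-1 <= E V.
Proof.
have c2 := c_half; move=> bc.
(* On [2/3, 1] the nearest point is [c], since any other point lies to its left. *)
have J2 : (3^-1) ^+ 2 / 8 + (3^-1 / 2 + (2 / 3 - c)) ^+ 2 <= E (V \o Tb true).
  apply: half_ge => x b x01 bs; rewrite /sqdist /= /T2.
  case: (straddle _ bs) (bc _ bs) => [->|[b1 b2]|[]] b3; last by lra.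
    by rewrite le_eqVlt; apply/orP; left; apply/eqP; field.
  rewrite -subr_ge0; have -> : (x / 3 + 2 / 3 - b) ^+ 2 - (3^-1 * x + (2 / 3 - c)) ^+ 2
     = (c - b) * (2 * (x / 3 + 2 / 3) - b - c) by field.
  by apply: mulr_ge0; lra.
have := J_ge0 false false.
rewrite (cantor_mean_self HE cV) (cantor_mean_self HE (continuous_comp_Tb _ false cV)).
(* 37/54 minimizes the quadratic in [c] formed by a quarter of the bound [J12_ge] and half of
   [J2]. *)
by move: J12_ge J2 (sqr_ge0 (c - 37 / 54)); lra.
Qed.

Let straddle_three (a b : R) : a < c -> c < b -> a <= 2 / 3 - c -> 4 / 3 - c <= b ->
  (forall x, x \in s -> [\/ x = a, x = c | x = b]) -> 5 / 648 <= E V.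
Proof.
have c2 := c_half; move=> ac cb a_le b_ge s_abc.
(* [c] may be nearer than [a] to some points of [[0, 1/9]], but there the cost is
   still at least the squared distance to [max a (-1/6)]. *)
have J11 : (9^-1) ^+ 2 / 8 + (9^-1 / 2 - Num.max a (- 6^-1)) ^+ 2
    <= E (V \o Tb false \o Tb false).
  apply: J_ge => x d x01 /s_abc ds; rewrite /sqdist /= /T1.
  have [a6|a6] := leP a (- 6^-1).
    by apply: ler_sqr_or; [lra|case: ds => ->; [left|right|right]; lra].
  have [xa|xa] := leP a (9^-1 * x).
    by apply: ler_sqr_or; [lra|case: ds => ->; [left|right|right]; lra].
  by rewrite -sqrrN; apply: ler_sqr_or; [lra|right; case: ds => ->; lra].
have sq1 := sqr_ge0 (9^-1 / 2 - Num.max a (- 6^-1)).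
rewrite (cantor_mean_self2 HE _ cV).
(* From c = 5/9 on, the two left cylinders suffice: (1/648 + 1/648 + 1/36) / 4 = 5/648. *)
have [c59|c59] := leP (5 / 9) c.
  by move: J11 J12_ge (J_ge0 true false) (J_ge0 true true); nra.
(* The minorant is the distance to 4/3 - c, and c < 5/9 keeps it nonnegative on [2/3, 7/9]. *)
have J21 : (- 9^-1) ^+ 2 / 8 + (- 9^-1 / 2 + (2 / 3 - c)) ^+ 2
    <= E (V \o Tb true \o Tb false).
  apply: J_ge => x d x01 /straddle ds; rewrite /sqdist /= /T1 /T2.
  by apply: ler_sqr_or; [lra|case: ds => [->|[]|[]] *; [left|left|right]; lra].
(* Mirror image of [J11]: the cap 7/6 is 1 - (-1/6), and points of [8/9, 1] are nearer to it than to
   [c]. *)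
have J22 : (9^-1) ^+ 2 / 8 + (9^-1 / 2 + (8 / 9 - Num.min b (7 / 6))) ^+ 2
    <= E (V \o Tb true \o Tb true).
  apply: J_ge => x d x01 /s_abc ds; rewrite /sqdist /= /T2.
  have [b7|b7] := leP b (7 / 6); last first.
    by rewrite -sqrrN; apply: ler_sqr_or; [lra|case: ds => ->; [left|left|right]; lra].
  have [xb|xb] := leP b (9^-1 * x + 8 / 9).
    by apply: ler_sqr_or; [lra|left; case: ds => ->; lra].
  by rewrite -sqrrN; apply: ler_sqr_or; [lra|case: ds => ->; [left|left|right]; lra].
have sq2 := sqr_ge0 (9^-1 / 2 + (8 / 9 - Num.min b (7 / 6))).
(* The four variances add up to 4/648, and (c - 7/18)^2 + (11/18 - c)^2 is at least 2/81 = 16/648; a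
   quarter of the sum is 5/648. *)
by move: J11 J12_ge J21 J22; nra.
Qed.

Lemma quant_bound_straddle (l : nat) : (2 <= size s)%N -> quant_bound l (size s) <= E V.
Proof.
move=> s2.
have [cb|/existsNP[a /not_implyP[aS /negP]]] := pselect (forall b, b \in s -> c <= b).
  exact: le_trans (quant_bound_le2 l _ s2) (straddle_right cb).
rewrite -ltNge => ac.
have [bc|/existsNP[b /not_implyP[bS /negP]]] := pselect (forall b, b \in s -> b <= c).
  exact: le_trans (quant_bound_le2 l _ s2) (straddle_left bc).
rewrite -ltNge => cb.
have abc_uniq : uniq [:: a; c; b].
  by rewrite /= !inE negb_or !lt_eqF// (lt_trans ac cb).
have abc_s : {subset [:: a; c; b] <= s}.
  by move=> x; rewrite !inE => /or3P[] /eqP ->.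
(* For four or more points the cylinder [2/9, 1/3] alone gives (1/648 + 1/81) / 4 = 1/288, above
   1/648. *)
have [s4|s3] := leqP 4 (size s).
  apply: le_trans (quant_bound_le4 l _ s4) _.
  rewrite (cantor_mean_self2 HE _ cV).
  move: J12_ge (J_ge0 false false) (J_ge0 true false) (J_ge0 true true).
  by move: c_half; nra.
apply: le_trans (quant_bound_le3 l _ (uniq_leq_size abc_uniq abc_s)) _.
(* At most three entries, among them three distinct ones: the codebook is exactly [a], [c], [b]. *)
have [_ sE] := uniq_min_size abc_uniq abc_s s3.
apply: (@straddle_three a b) => //.
- by case: (straddle _ aS) => [aE|[]|[]] *; lra.
- by case: (straddle _ bS) => [bE|[]|[]] *; lra.
- by move=> x; rewrite -sE !inE => /or3P[] /eqP ->; [exact: Or31|exact: Or32|exact: Or33].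
Qed.

End Straddle.

(** * Lower bound for the unconstrained error *)

Section LowerBound.
Context {R : realType}.
Implicit Types (E : (R -> R) -> R) (s : seq R).

Lemma mincost_sqdist_reflect s : s != [::] ->
  mincost sqdist [seq 1 - b | b <- s] \o (fun x => 1 - x) = mincost sqdist s.
Proof.
move=> s0; have s0' : [seq 1 - b | b <- s] != [::] by case: s s0.
apply/funext => x /=; apply/eqP; rewrite eq_le; apply/andP; split.
  have [b bs ->] := mincost_attained sqdist _ x s0.
  apply: le_trans (mincost_le sqdist _ _ _ (map_f (fun b => 1 - b) bs)) _.
  by rewrite le_eqVlt; apply/orP; left; apply/eqP; rewrite /sqdist; ring.
have [_ /mapP[b bs ->] ->] := mincost_attained sqdist _ (1 - x) s0'.
apply: le_trans (mincost_le sqdist _ _ x bs) _.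
by rewrite le_eqVlt; apply/orP; left; apply/eqP; rewrite /sqdist; ring.
Qed.

Lemma quant_bound_straddle_any E (HE : cantor_mean E) (l : nat) s (c : R) :
  c \in s -> (2 <= size s)%N ->
  (forall b, b \in s ->
     [\/ b = c, b < c /\ b <= 2 / 3 - c | c < b /\ 4 / 3 - c <= b]) ->
  quant_bound l (size s) <= E (mincost sqdist s).
Proof.
move=> cs s2 sc; have [c_half|c_half] := leP (1 / 2) c.
  exact: (quant_bound_straddle HE _ _ cs).
have s0 : s != [::] by case: (s) s2.
rewrite -(mincost_sqdist_reflect _ s0) -(size_map (fun b => 1 - b) s).
apply: (quant_bound_straddle (cantor_mean_reflect HE) _ (1 - c)).
- exact: (map_f (fun b => 1 - b)).
- by lra.
- move=> _ /mapP[b /sc bs ->]; case: bs => [->|[b1 b2]|[b1 b2]].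
  + exact: Or31.
  + by apply: Or33; split; lra.
  + by apply: Or32; split; lra.
- by rewrite size_map.
Qed.

(** For [b] in [s]: the closed Voronoi cell of [b] meets [A]. *)
Definition nearest_on (s : seq R) (A : set R) : pred R :=
  fun b => `[< exists2 x, A x & forall d, d \in s -> sqdist b x <= sqdist d x >].

Lemma nearest_on_rescale s (i : bool) (x : R) : s != [::] -> 0 <= x <= 1 ->
  let t := [seq b <- s | nearest_on s (Tb i @` [set y | 0 <= y <= 1]) b] in
  t != [::] /\
  9^-1 * mincost sqdist [seq 3 * b - (if i then 2 else 0) | b <- t] x
    <= mincost sqdist s (Tb i x).
Proof.
move=> s0 x01 t; have [b bs bE] := mincost_attained sqdist _ (Tb i x) s0.
have bt : b \in t.
  rewrite mem_filter bs andbT; apply/asboolP; exists (Tb i x); first by exists x.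
  by move=> d ds; rewrite -bE; exact: mincost_le.
split; first by move: bt; case: (t).
have := mincost_le sqdist _ _ x (map_f (fun b => 3 * b - (if i then 2 else 0)) bt).
rewrite bE -(@ler_pM2l _ 9^-1) ?invr_gt0//.
move/le_trans; apply; rewrite le_eqVlt; apply/orP; left; apply/eqP.
by rewrite /sqdist; case: i {t bE bt} => /=; rewrite /T1 /T2; field.
Qed.

Lemma mincost_split E (HE : cantor_mean E) s : s != [::] ->
  (exists2 c, c \in s & forall b, b \in s ->
     [\/ b = c, b < c /\ b <= 2 / 3 - c | c < b /\ 4 / 3 - c <= b])
  \/ exists s1 s2 : seq R, [/\ s1 != [::], s2 != [::],
      (size s1 + size s2 <= size s)%N &
      (E (mincost sqdist s1) + E (mincost sqdist s2)) / 18 <= E (mincost sqdist s)].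
Proof.
move=> s0; pose J i := [set Tb i y | y in [set y : R | 0 <= y <= 1]].
have [|] := boolP (has (predI (nearest_on s (J false)) (nearest_on s (J true))) s).
  move=> /hasP[c cs /andP[/asboolP[_ [x /= x01 <-] xmin] /asboolP[_ [y /= y01 <-] ymin]]].
  (* As [c] is nearest to a point of [0, 1/3], the midpoint of [c] and any [b] to its left is at
     most 1/3; likewise it is at least 2/3 for [b] to its right. *)
  left; exists c => // b bs; have [bc|bc|->] := ltgtP b c; last exact: Or31.
    apply: Or32; split => //; have := xmin b bs; rewrite /sqdist /= /T1 => xb.
    rewrite leNgt; apply/negP => b_gt.
    have : 0 < (c - b) * (b + c - 2 * (x / 3)) by apply: mulr_gt0; lra.
    by nra.
  apply: Or33; split => //; have := ymin b bs; rewrite /sqdist /= /T2 => yb.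
  rewrite leNgt; apply/negP => b_lt.
  have : 0 < (b - c) * (2 * (y / 3 + 2 / 3) - b - c) by apply: mulr_gt0; lra.
  by nra.
rewrite has_count -eqn0Ngt => /eqP countI; right.
pose t i := [seq b <- s | nearest_on s (J i) b].
pose u i := [seq 3 * b - (if i then 2 else 0) | b <- t i].
have x01 : 0 <= (0 : R) <= 1 by rewrite lexx ler01.
exists (u false), (u true); split.
- by have [] := nearest_on_rescale s false 0 s0 x01; rewrite -/(t false) /u; case: (t _).
- by have [] := nearest_on_rescale s true 0 s0 x01; rewrite -/(t true) /u; case: (t _).
(* No entry passes both filters, so the two counts add up to that of the union. *)
- rewrite !size_map !size_filter -count_predUI countI addn0; exact: count_size.
have cs v : continuous (mincost (@sqdist R) v).
  by apply: continuous_mincost => b; exact: continuous_sqdist.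
have half i : 9^-1 * E (mincost sqdist (u i)) <= E (mincost sqdist s \o Tb i).
  rewrite -(cantor_meanZ HE)//; apply: (cantor_mean_le HE).
  - by move=> x; apply: cvgM; [exact: cvg_cst|exact: cs].
  - exact: continuous_comp_Tb.
  - by move=> x x01'; have [] := nearest_on_rescale s i x s0 x01'.
(* The factor 1/18 is the weight 1/2 times the scaling 1/9. *)
rewrite (cantor_mean_self HE (cs s)); move: (half false) (half true); lra.
Qed.

Lemma quant_bound_le_mincost E (HE : cantor_mean E) (l : nat) s : s != [::] ->
  quant_bound l (size s) <= E (mincost sqdist s).
Proof.
have one v : size v = 1%N -> 8^-1 <= E (mincost sqdist v).
  case: v => [|b []]//= _.
  have -> : mincost sqdist [:: b] = (fun x => (1 * x + - b) ^+ 2).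
    by apply/funext => x; rewrite mul1r.
  by rewrite (cantor_mean_affine_sqr HE); have := sqr_ge0 (1 / 2 - b); lra.
elim: l s => [|l IHl] s s0; have [s1|s2|s3] := ltngtP (size s) 2.
- have {s1} s1 : size s = 1%N by case: s s0 s1 => [|? []].
  by apply: le_trans (one _ s1); apply: quant_bound_le1; rewrite s1.
(* At level 0 the bound is negative from three points on. *)
- apply: (@le_trans _ _ 0).
    apply: le_trans (quant_bound_anti 0 _ _ s2) _.
    by rewrite /quant_bound; lra.
  apply: (cantor_mean_ge0 HE) => [|x _].
    by apply: continuous_mincost => b; exact: continuous_sqdist.
  by apply: mincost_ge => // b _; exact: sqr_ge0.
- have [[c cs straddle]|[v [w [v0 w0 vw E_ge]]]] := mincost_split _ HE _ s0.
    by apply: (quant_bound_straddle_any _ HE _ _ _ cs) => //; rewrite s3.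
  (* Two points split into one on each side, giving (1/8 + 1/8) / 18 = 1/72. *)
  have v1 : size v = 1%N by case: v v0 vw {E_ge} => [|? []]//; case: w w0 => //= *; lia.
  have w1 : size w = 1%N.
    by case: w w0 vw {E_ge} => [|? []]//; case: v v0 {v1} => //= *; lia.
  have := one _ v1; have := one _ w1; have := quant_bound_le2 0 (size s).
  by rewrite s3 => /(_ R isT); lra.
- have {s1} s1 : size s = 1%N by case: s s0 s1 => [|? []].
  by apply: le_trans (one _ s1); apply: quant_bound_le1; rewrite s1.
all: have [[c cs straddle]|[v [w [v0 w0 vw E_ge]]]] := mincost_split _ HE _ s0.
- by apply: (quant_bound_straddle_any _ HE _ _ _ cs) => //; exact: ltnW.
- apply: le_trans (quant_bound_anti _ _ _ vw) _; rewrite quant_boundD.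
  by apply: le_trans E_ge; rewrite ler_wpM2r ?invr_ge0// lerD ?IHl.
- by apply: (quant_bound_straddle_any _ HE _ _ _ cs) => //; rewrite s3.
- apply: le_trans (quant_bound_anti _ _ _ vw) _; rewrite quant_boundD.
  by apply: le_trans E_ge; rewrite ler_wpM2r ?invr_ge0// lerD ?IHl.
Qed.

End LowerBound.

(** * The Cantor measure: support in [0, 1] and its integral as a self-similar mean *)

Section CantorMeasure.
Context {R : realType} (P : probability R R) (HP : cantor_selfsimilar P).

Let measurable_continuous (f : R -> R) : continuous f -> measurable_fun setT f.
Proof. exact: continuous_measurable_fun. Qed.

Let continuous_maxr (f g : R -> R) : continuous f -> continuous g ->
  continuous (fun x => Num.max (f x) (g x)).
Proof. by move=> cf cg x; exact: (@continuous_max R R f g x (cf x) (cg x)). Qed.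

(** [P] agrees on measurable sets with half the sum of its pushforwards under the two maps, so a
    change of variables applies. *)
Lemma ge0_integral_cantor (f : R -> \bar R) :
  measurable_fun setT f -> (forall x, 0 <= f x)%E ->
  (\int[P]_x f x = (2^-1)%:E * (\int[P]_x f (Tb false x) + \int[P]_x f (Tb true x)))%E.
Proof.
move=> mf f0; have mTb i : measurable_fun setT (@Tb R i).
  by apply: measurable_continuous; exact: continuous_Tb.
have half_ge0 : 0 <= 2^-1 :> R by rewrite invr_ge0.
pose h := NngNum half_ge0.
pose m i : {measure set R -> \bar R} := mscale h (pushforward P (@Tb R i)).
pose mu := measure_add (m mTb false) (m mTb true).
rewrite (@eq_measure_integral _ _ _ setT mu); last first.
  move=> A mA _; apply: (etrans (HP A mA)).
  exact: (esym (measure_addE (m mTb false) (m mTb true) A)).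
rewrite ge0_integral_measure_add// !ge0_integral_mscale// !ge0_integral_pushforward//.
by rewrite !preimage_setT [RHS]ge0_muleDr//; exact: integral_ge0.
Qed.

Lemma cantor_support : P (~` `[0, 1]) = 0%E.
Proof.
(* [d] is the distance to [0, 1], which both maps shrink by 3; comparing the
   integrals of the bounded functions [1 - 1 / (1 + r d)] for [r = 1] and
   [r = 1/3] shows that [d = 0] almost everywhere. *)
pose d (x : R) : R := Num.max (Num.max (- x) (x - 1)) 0.
have d0 x : 0 <= d x by rewrite /d le_max lexx orbT.
have dT i x : d (Tb i x) <= d x / 3.
  have xd : - x <= d x by rewrite /d !le_max lexx.
  have xd1 : x - 1 <= d x by rewrite /d !le_max lexx orbT.
  have dx0 := d0 x.
  by rewrite {1}/d !ge_max; case: i; rewrite /= /T1 /T2; do ?[apply/andP; split]; lra.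
have cd : continuous d.
  apply: continuous_maxr; last exact: cst_continuous.
  apply: continuous_maxr => x; first by apply: cvgN; exact: cvg_id.
  by apply: cvgB; [exact: cvg_id|exact: cvg_cst].
pose f (r x : R) : R := 1 - (1 + r * d x)^-1.
have rd_gt0 r x : 0 <= r -> 0 < 1 + r * d x by move=> r0; rewrite ltr_pwDl ?mulr_ge0.
have f_le r s x y : 0 <= r -> 0 <= s -> (f r x <= f s y) = (r * d x <= s * d y).
  by move=> r0 s0; rewrite /f lerD2l lerN2 lef_pV2 ?posrE ?rd_gt0// lerD2l.
have cf r : 0 <= r -> continuous (f r).
  move=> r0 x; apply: cvgB; first exact: cvg_cst.
  apply: cvgV; first by rewrite gt_eqF ?rd_gt0.
  by apply: cvgD; [exact: cvg_cst|apply: cvgM; [exact: cvg_cst|exact: cd]].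
have f0 r x : 0 <= r -> 0 <= f r x.
  by move=> r0; rewrite subr_ge0 invf_le1 ?rd_gt0// lerDl mulr_ge0.
have mf r : 0 <= r -> measurable_fun setT (fun x => (f r x)%:E).
  by move=> r0; apply/measurable_EFinP; apply: measurable_continuous; exact: cf.
have f1 r x : 0 <= r -> f r x <= 1.
  by move=> r0; rewrite gerBl invr_ge0 ltW ?rd_gt0.
have f3 x : f 3^-1 x <= f 1 x by rewrite f_le//; have := d0 x; lra.
have fT i x : f 1 (Tb i x) <= f 3^-1 x by rewrite f_le//; have := dT i x; lra.
have mf1 := mf 1 ler01.
have mf3 : measurable_fun setT (fun x => (f 3^-1 x)%:E) by exact: mf.
have fin3 : (\int[P]_x (f 3^-1 x)%:E)%E \is a fin_num.
  rewrite ge0_fin_numE; last by apply: integral_ge0 => x _; rewrite lee_fin f0.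
  apply: (@le_lt_trans _ _ (\int[P]_x (cst 1%:E x))%E); last first.
    by rewrite integral_cst// mul1e [X in (X < _)%E]probability_setT ltry.
  by apply: ge0_le_integral => //= x _; rewrite lee_fin ?f0 ?f1.
(* This opposes the pointwise inequality [f3]; since the right-hand integral is finite, the
   difference [h] integrates to 0. *)
have int_le : (\int[P]_x (f 1 x)%:E <= \int[P]_x (f 3^-1 x)%:E)%E.
  rewrite ge0_integral_cantor//; last by move=> x; rewrite lee_fin f0.
  have half_le i : (\int[P]_x (f 1 (Tb i x))%:E <= \int[P]_x (f 3^-1 x)%:E)%E.
    apply: ge0_le_integral => //; try by move=> x _; rewrite lee_fin ?f0 ?fT.
    apply/measurable_EFinP; apply: measurable_continuous.
    exact: (continuous_comp_Tb (f 1) i (cf 1 ler01)).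
  apply: (@le_trans _ _ ((2^-1)%:E *
      (\int[P]_x (f 3^-1 x)%:E + \int[P]_x (f 3^-1 x)%:E))%E).
    by apply: lee_wpmul2l; [rewrite lee_fin|exact: leeD].
  by rewrite -(fineK fin3) -EFinD -EFinM lee_fin; lra.
pose h x := f 1 x - f 3^-1 x.
have h0 x : 0 <= h x by rewrite subr_ge0.
have mh : measurable_fun setT (fun x => (h x)%:E).
  apply/measurable_EFinP; apply: measurable_continuous => x.
  by apply: cvgB; apply: cf.
have int_h : (\int[P]_x `|(h x)%:E| = 0)%E.
  under eq_integral do rewrite gee0_abs ?lee_fin//.
  apply/eqP; rewrite eq_le; apply/andP; split; last first.
    by apply: integral_ge0 => x _; rewrite lee_fin.
  rewrite -(leeD2lE _ _ fin3) adde0 -ge0_integralD//;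
    try by move=> x _; rewrite lee_fin ?f0.
  by under eq_integral do rewrite -EFinD /h addrC subrK.
apply: measure_negligible; first by apply: measurableC; exact: measurable_itv.
have := (ae_eq_integral_abs P measurableT mh).1 int_h.
apply: negligibleS => x /= x01 /(_ Logic.I) [] hx; apply: x01; rewrite in_itv/=.
have : f 1 x <= f 3^-1 x by move: hx; rewrite /h; lra.
rewrite f_le// => dx; have : d x <= 0 by lra.
by rewrite /d !ge_max; lra.
Qed.

Local Notation E f := (\int[P]_(x in `[0, 1]) f x)%R.

Lemma continuous_integrable01 (f : R -> R) :
  continuous f -> P.-integrable `[0, 1] (EFin \o f).
Proof.
move=> cf; have cpt := @segment_compact R 0 1.
apply: measurable_bounded_integrable => //.
- by apply: le_lt_trans (probability_le1 P _) _; rewrite ?ltry//.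
- by apply: measurable_funTS; exact: measurable_continuous.
- have /compact_bounded[M [_ mrt]] := continuous_compact (continuous_subspaceT cf) cpt.
  by exists M; split; rewrite ?num_real // => ? ? ? ?; exact: mrt.
Qed.

Lemma ge0_integral_cantor01 (f : R -> R) : continuous f -> (forall x, 0 <= f x) ->
  (\int[P]_x (f x)%:E)%E = (E f)%:E.
Proof.
move=> cf f0; rewrite (@ge0_negligible_integral _ _ _ P setT (~` `[0, 1]))//.
- rewrite setTD setCK fineK//; apply: integrable_fin_num => //.
  exact: continuous_integrable01.
- exact: measurableC.
- by apply/measurable_EFinP; exact: measurable_continuous.
- by move=> x _; rewrite lee_fin.
- exact: cantor_support.
Qed.

Lemma cantor_mean_Rintegral : cantor_mean (fun f => E f).
Proof.
have P01 : P `[0, 1]%classic = 1%E.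
  have := probability_setC P (measurable_itv `[(0 : R), 1]).
  by rewrite cantor_support => /eqP; rewrite eq_sym sube_eq// ?add0e => /eqP ->.
have cst1 r : E (fun=> r) = r by rewrite Rintegral_cst// [X in fine X]P01 mulr1.
have ED (f g : R -> R) : continuous f -> continuous g ->
    E (fun x => f x + g x) = E f + E g.
  by move=> cf cg; apply: RintegralD => //; exact: continuous_integrable01.
split; first exact: ED.
- by move=> k f cf; apply: RintegralZl => //; exact: continuous_integrable01.
- exact: cst1.
- move=> f g cf cg fg; apply: le_Rintegral => //; exact: continuous_integrable01.
move=> f cf; have [c _ f_ge] : exists2 c : R, c \in `[(0 : R), 1]%R &
    forall t : R, t \in `[(0 : R), 1]%R -> f c <= f t.
  by apply: EVT_min => //; exact: continuous_subspaceT.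
(* Self-similarity is available for nonnegative integrands on the whole line; subtracting the
   minimum over [0, 1] and truncating at 0 changes [f] there only by a constant. *)
pose g x := Num.max (f x - f c) 0.
have cg : continuous g.
  apply: continuous_maxr; last exact: cst_continuous.
  by move=> x; apply: cvgB; [exact: cf|exact: cvg_cst].
have Eg (h : R -> R) : continuous h -> (forall x : R, 0 <= x <= 1 -> 0 <= h x <= 1) ->
    E (g \o h) = E (f \o h) - f c.
  move=> ch h01; rewrite -[X in _ + X]cst1 -ED; last 2 first.
  - by move=> x; apply: continuous_comp; [exact: ch|exact: cf].
  - exact: cst_continuous.
  apply: eq_Rintegral => x; rewrite inE/= in_itv/= => /h01 hx.
  by rewrite /g/= max_l// subr_ge0 f_ge// in_itv.
have g0 x : 0 <= g x by rewrite le_max lexx orbT.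
have g_self : E g = 2^-1 * (E (g \o Tb false) + E (g \o Tb true)).
  apply: EFin_inj; rewrite EFinM EFinD -!ge0_integral_cantor01//;
    try exact: (continuous_comp_Tb g); try by move=> x; exact: g0.
  apply: ge0_integral_cantor => [|x]; last by rewrite lee_fin.
  by apply/measurable_EFinP; exact: measurable_continuous.
have T01 i (x : R) : 0 <= x <= 1 -> 0 <= Tb i x <= 1.
  by case: i; rewrite /= /T1 /T2; lra.
have cid : continuous (fun x : R => x) by move=> x; exact: cvg_id.
have := Eg id cid (fun x => id).
have := Eg _ (@continuous_Tb R false) (T01 false).
have := Eg _ (@continuous_Tb R true) (T01 true).
move: g_self; rewrite [g \o id]/comp [f \o id]/comp; lra.
Qed.

End CantorMeasure.

(** * Decomposition of the mean along words *)

Lemma Tword_rcons {R : realType} (s : seq bool) (b : bool) (x : R) :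
  Tword (rcons s b) x = Tword s (Tb b x).
Proof. by rewrite /Tword foldr_rcons. Qed.

Lemma Tword_aw {R : realType} (s : seq bool) (x : R) :
  Tword s x = (3 ^+ size s)^-1 * x + (aw R s - (3 ^+ size s)^-1 / 2).
Proof.
elim: s => [|b s IHs]; first by rewrite /aw /= expr0; field.
have -> : aw R (b :: s) = Tb b (aw R s) by [].
have -> : size (b :: s) = (size s).+1 by [].
rewrite [Tword _ _]/(Tb b (Tword s x)) IHs exprS invfM.
by case: b => /=; rewrite /T1 /T2; field; exact: expf_neq0.
Qed.

Lemma big_tuple_cons {R : realType} (l : nat) (F : seq bool -> R) :
  \sum_(s : l.+1.-tuple bool) F s =
  \sum_(s : l.-tuple bool) F (false :: s) + \sum_(s : l.-tuple bool) F (true :: s).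
Proof.
rewrite (reindex (fun p : bool * l.-tuple bool => [tuple of p.1 :: p.2])); last first.
  exists (fun t => (thead t, [tuple of behead t])) => [[b s] _|t _].
    by congr pair; apply: val_inj.
  by rewrite [RHS]tuple_eta; apply: val_inj.
by rewrite -(pair_bigA _ (fun b (s : l.-tuple bool) => F (b :: s))) big_bool addrC.
Qed.

Section Words.
Context {R : realType} {E : (R -> R) -> R} (HE : cantor_mean E).

Lemma continuous_comp_Tword (f : R -> R) (s : seq bool) :
  continuous f -> continuous (f \o Tword s).
Proof.
move=> cf; have -> : Tword s = (fun x : R =>
  (3 ^+ size s)^-1 * x + (aw R s - (3 ^+ size s)^-1 / 2)).
  by apply/funext => x; rewrite Tword_aw.
by move=> x; apply: continuous_comp; [exact: continuous_affine|exact: cf].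
Qed.

Lemma cantor_mean_words (l : nat) (f : R -> R) : continuous f ->
  E f = \sum_(s : l.-tuple bool) (2 ^+ l)^-1 * E (f \o Tword s).
Proof.
elim: l f => [|l IHl] f cf.
  rewrite (bigD1 [tuple]) //= big1 ?addr0 ?expr0 ?invr1 ?mul1r//.
  by move=> s /negP[]; apply/eqP; exact: tuple0.
rewrite (@big_tuple_cons _ l (fun s => (2 ^+ l.+1)^-1 * E (f \o Tword s))).
rewrite (cantor_mean_self HE cf) !(IHl _ (continuous_comp_Tb _ _ cf)) mulrDr.
by congr (_ + _); rewrite mulr_sumr; apply: eq_bigr => s _;
  rewrite mulrA -invfM -exprS.
Qed.

(** Cylinders of words in [I] are cut once more, so that each piece has its centre as a codebook
    point. *)
Lemma cantor_mean_refined_words (l : nat) (I : {set l.-tuple bool}) (f : R -> R) :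
  continuous f ->
  E f = \sum_(s in ~: I) (2 ^+ l)^-1 * E (f \o Tword s)
      + \sum_(s in I) (2 ^+ l.+1)^-1 *
          (E (f \o Tword (rcons s false)) + E (f \o Tword (rcons s true))).
Proof.
move=> cf; rewrite (cantor_mean_words l _ cf) (bigID (mem I)) /= addrC.
congr (_ + _); first by apply: eq_bigl => s; rewrite inE.
apply: eq_bigr => s _; rewrite (cantor_mean_self HE (continuous_comp_Tword _ s cf)).
rewrite mulrA -invfM -exprSr; congr (_ * (E _ + E _));
  by apply/funext => x /=; rewrite Tword_rcons.
Qed.

Lemma cantor_mean_Tword_sqr (s : seq bool) (q : R) :
  E (fun x => (Tword s x + q) ^+ 2) = (9 ^+ size s)^-1 / 8 + (aw R s + q) ^+ 2.
Proof.
have -> : (fun x => (Tword s x + q) ^+ 2) = (fun x => ((3 ^+ size s)^-1 * x +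
    (aw R s - (3 ^+ size s)^-1 / 2 + q)) ^+ 2).
  by apply/funext => x; rewrite Tword_aw -[in LHS]addrA.
rewrite (cantor_mean_affine_sqr HE) exprVn -exprM mulnC exprM.
by rewrite (_ : 3 ^+ 2 = 9 :> R); [congr (_ + _); ring|ring].
Qed.

End Words.

(** * Error of the explicit codebook and evaluation of [A_nI] *)

Section CantorCodebook.
Context {R : realType} {E : (R -> R) -> R} (HE : cantor_mean E).
Context (n l : nat) (I : {set l.-tuple bool}).
Hypotheses (nl : (2 ^ l <= n)%N) (cardI : #|I| = (n - 2 ^ l)%N).

(** There are 2^(l+1) - n undivided cylinders and n - 2^l divided ones; each piece contributes its
    mass times its variance. *)
Lemma quant_boundE : (quant_bound l n : R) =
  \sum_(s in ~: I) (2 ^+ l)^-1 * ((9 ^+ l)^-1 / 8)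
  + \sum_(s in I) (2 ^+ l.+1)^-1 * ((9 ^+ l.+1)^-1 / 8 + (9 ^+ l.+1)^-1 / 8).
Proof.
have cardIR : #|I|%:R = n%:R - 2 ^+ l :> R by rewrite cardI natrB// natrX.
have cardIC : #|~: I|%:R = 2 ^+ l - #|I|%:R :> R.
  by rewrite -natrX -card_bool -card_tuple -(cardsC I) natrD; ring.
rewrite !sumr_const -[_ *+ #|~: I|]mulr_natl -[_ *+ #|I|]mulr_natl.
rewrite cardIC cardIR /quant_bound !exprS.
rewrite (_ : 18 = 9 * 2 :> R); last by ring.
by rewrite exprMn; field; rewrite !expf_neq0.
Qed.

Lemma mincost_cantor_le (s : seq R) : s != [::] ->
  (forall w, w \in ~: I -> aw R (val w) \in s) ->
  (forall w b, w \in I -> aw R (rcons (val w) b) \in s) ->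
  E (mincost sqdist s) <= quant_bound l n.
Proof.
move=> s0 sC sI; have cs : continuous (mincost sqdist s).
  by apply: continuous_mincost => b; exact: continuous_sqdist.
have word_le w : aw R w \in s -> E (mincost sqdist s \o Tword w) <= (9 ^+ size w)^-1 / 8.
  move=> ws; have := cantor_mean_Tword_sqr HE w (- aw R w).
  rewrite subrr expr0n addr0 => <-; apply: (cantor_mean_le HE).
  - exact: continuous_comp_Tword.
  - apply: (@continuous_comp_Tword _ (fun x => (x - aw R w) ^+ 2)).
    exact: (@continuous_sqdist R (aw R w)).
  - by move=> x _; exact: (mincost_le sqdist _ _ _ ws).
rewrite (cantor_mean_refined_words HE _ I _ cs) quant_boundE.
apply: lerD; apply: ler_sum => w wI; rewrite ler_wpM2l ?invr_ge0 ?exprn_ge0//.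
  by apply: le_trans (word_le _ (sC _ wI)) _; rewrite size_tuple.
apply: lerD.
  by apply: le_trans (word_le _ (sI _ _ wI)) _; rewrite size_rcons size_tuple.
by apply: le_trans (word_le _ (sI _ _ wI)) _; rewrite size_rcons size_tuple.
Qed.

Lemma rho_Uninv (x u : R) :
  rho x (Uninv n u) = ((x - u) ^+ 2 + (x + n%:R^-1) ^+ 2) / 2.
Proof. by rewrite /rho /Uninv /=; move: (n%:R^-1) => k; field. Qed.

(** At x = u the first square in [rho_Uninv] vanishes, so twice [A_nI] collects the values of (x +
    1/n)^2 at the centres; the cylinder variances make up the rest. *)
Lemma cantor_mean_A_nI :
  E (fun x => (x + n%:R^-1) ^+ 2) = quant_bound l n + 2 * A_nI n I.
Proof.
have rho_aw w : (aw R w + n%:R^-1) ^+ 2 = 2 * rho (aw R w) (Uninv n (aw R w)) :> R.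
  by rewrite rho_Uninv subrr expr0n add0r; lra.
rewrite (cantor_mean_refined_words HE _ I _ (@continuous_shift_sqr R _)).
have word w : E ((fun x => (x + n%:R^-1) ^+ 2) \o Tword w) =
    (9 ^+ size w)^-1 / 8 + 2 * rho (aw R w) (Uninv n (aw R w)).
  by rewrite -rho_aw -(cantor_mean_Tword_sqr HE).
rewrite quant_boundE /A_nI [2 * (_ + _)]mulrDr !mulr_sumr addrACA -!big_split /=.
by congr (_ + _); apply: eq_bigr => w _; rewrite !word ?size_rcons size_tuple; ring.
Qed.

End CantorCodebook.

(** * Reduction of the constrained error to the unconstrained one *)

Section Quantization.
Context {R : realType} (P : probability R R) (HP : cantor_selfsimilar P).
Local Notation E f := (\int[P]_(x in `[0, 1]) f x)%R.

Lemma rhoE (x : R) (a : R * R) :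
  rho x a = ((x - (a.1 + a.2)) ^+ 2 + (x + (a.2 - a.1)) ^+ 2) / 2.
Proof. by rewrite /rho; field. Qed.

Let continuous_rho (a : R * R) : continuous (fun x : R => rho x a).
Proof.
move=> x; apply: cvgD; last exact: cvg_cst.
exact: (@continuous_sqdist R a.1).
Qed.

Lemma Vline_mincost (be : {fset R}) : (0 < #|` be|)%N ->
  Vline P be = (E (mincost sqdist be))%:E.
Proof.
move=> be0; have {}be0 : (be : seq _) != [::] by rewrite -size_eq0 -lt0n.
rewrite -(ge0_integral_cantor01 P HP).
- by apply: eq_integral => x _; exact: bigmin_mincost.
- by apply: continuous_mincost => b; exact: continuous_sqdist.
- by move=> x; apply: mincost_ge => // b _; exact: sqr_ge0.
Qed.

Lemma Vq_mincost (al : {fset R * R}) : (0 < #|` al|)%N ->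
  Vq P al = (E (mincost (fun a x => rho x a) al))%:E.
Proof.
move=> al0; have {}al0 : (al : seq _) != [::] by rewrite -size_eq0 -lt0n.
rewrite -(ge0_integral_cantor01 P HP).
- by apply: eq_integral => x _; exact: bigmin_mincost.
- by apply: continuous_mincost => b; exact: continuous_rho.
- by move=> x; apply: mincost_ge => // b _; rewrite addr_ge0// sqr_ge0.
Qed.

Lemma Vline_ge (l n : nat) (be : {fset R}) : (0 < #|` be| <= n)%N ->
  ((quant_bound l n)%:E <= Vline P be)%E.
Proof.
move=> /andP[be0 ben]; rewrite Vline_mincost// lee_fin.
apply: le_trans (quant_bound_anti l _ _ ben) _.
apply: (quant_bound_le_mincost _ (cantor_mean_Rintegral P HP)).
by rewrite -size_eq0 -lt0n.
Qed.

Lemma Vq_ge (l n : nat) (al : {fset R * R}) : admissible n al ->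
  (((quant_bound l n + E (fun x => (x + n%:R^-1) ^+ 2)) / 2)%:E <= Vq P al)%E.
Proof.
move=> [al_S /andP[al0 aln]]; rewrite Vq_mincost// lee_fin.
have al0' : (al : seq _) != [::] by rewrite -size_eq0 -lt0n.
(* Distinct points of the plane may share the same sum; a list with repetitions keeps the size, and
   the lower bound is stated for lists. *)
pose s := [seq a.1 + a.2 | a <- (al : seq (R * R))].
have s0 : s != [::] by rewrite -size_eq0 size_map size_eq0.
have HE := cantor_mean_Rintegral P HP.
have cs : continuous (mincost (@sqdist R) s).
  by apply: continuous_mincost => b; exact: continuous_sqdist.
have cq : continuous (fun x : R => (x + n%:R^-1) ^+ 2). exact: continuous_shift_sqr.
have sn : quant_bound l n <= E (mincost sqdist s).
  apply: le_trans (quant_bound_le_mincost _ HE l _ s0).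
  by apply: quant_bound_anti; rewrite size_map.
apply: (@le_trans _ _ (E (fun x => 2^-1 * (mincost sqdist s x + (x + n%:R^-1) ^+ 2)))).
  have csq : continuous (fun x => mincost sqdist s x + (x + n%:R^-1) ^+ 2).
    by move=> x; apply: cvgD; [exact: cs|exact: cq].
  by rewrite (cantor_meanZ HE _ csq) (cantor_meanD HE cs cq) mulrC ler_wpM2l ?lerD2r.
apply: (cantor_mean_le HE).
- move=> x; apply: cvgM; first exact: cvg_cst.
  by apply: cvgD; [exact: cs|exact: cq].
- by apply: continuous_mincost => a; exact: continuous_rho.
move=> x x01; apply: mincost_ge => // a aal; rewrite rhoE [leRHS]mulrC ler_wpM2l//.
apply: lerD; first exact: (mincost_le sqdist s _ x (map_f _ aal)).
have [j /= /andP[j1 jn] [_ a2E]] := al_S _ aal.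
have -> : a.2 - a.1 = j%:R^-1 by rewrite a2E addrC addKr.
have jV : n%:R^-1 <= j%:R^-1 :> R.
  by rewrite lef_pV2 ?posrE ?ltr0n ?ler_nat// (leq_trans j1 jn).
have n0 : 0 <= n%:R^-1 :> R by rewrite invr_ge0.
by apply: ler_sqr_or; [lra|left; lra].
Qed.

(** On [Sj n] the second square of [rhoE] is the same for all points, and [Un n] is the sum of the
    coordinates. *)
Lemma Vq_le (n : nat) (al : {fset R * R}) : (0 < #|` al|)%N ->
  [set` al] `<=` Sj n ->
  (Vq P al <= ((E (mincost sqdist [fset Un n a | a in al]%fset)
               + E (fun x => (x + n%:R^-1) ^+ 2)) / 2)%:E)%E.
Proof.
move=> al0 al_S; rewrite Vq_mincost// lee_fin.
have al0' : (al : seq _) != [::] by rewrite -size_eq0 -lt0n.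
set s := (X in mincost sqdist X).
have s0 : (s : seq R) != [::].
  have [a aal] : exists a, a \in al by apply/fset0Pn; rewrite -cardfs_gt0.
  have : Un n a \in s by exact: in_imfset.
  by rewrite /= ; case: (s : seq R).
have HE := cantor_mean_Rintegral P HP.
have cs : continuous (mincost (@sqdist R) s).
  by apply: continuous_mincost => b; exact: continuous_sqdist.
have cq : continuous (fun x : R => (x + n%:R^-1) ^+ 2).
  exact: continuous_shift_sqr.
have csq : continuous (fun x => mincost sqdist s x + (x + n%:R^-1) ^+ 2).
  by move=> x; apply: cvgD; [exact: cs|exact: cq].
rewrite -(cantor_meanD HE cs cq) mulrC -(cantor_meanZ HE _ csq).
apply: (cantor_mean_le HE).
- by apply: continuous_mincost => a; exact: continuous_rho.
- by move=> x; apply: cvgM; [exact: cvg_cst|exact: csq].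
move=> x _; have [_ /imfsetP[a /= aal ->] ->] := mincost_attained sqdist _ x s0.
apply: le_trans (mincost_le _ _ _ x aal) _; rewrite rhoE mulrC.
have [_ ->] := al_S _ aal.
rewrite /sqdist /Un le_eqVlt; apply/orP; left; apply/eqP.
by congr (_ * (_ ^+ 2 + _ ^+ 2)); ring.
Qed.

End Quantization.

Theorem mainTheorem6 (R : realType) (P : probability R R)
  (HP : cantor_selfsimilar P) (n l : nat) (I : {set l.-tuple bool})
  (Hn : (2 <= n)%N) (Hl : (2 ^ l <= n < 2 ^ l.+1)%N)
  (HI : #|I| = (n - 2 ^ l)%N) :
  let first := (18 ^+ l)^-1 * 8^-1 *
      ((2 ^ l.+1)%:R - n%:R + 9^-1 * (n - 2 ^ l)%:R) : R in
  constrained_optimal P n (alpha_n n I)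
  /\ Vn P n = Vq P (alpha_n n I)
  /\ Vq P (alpha_n n I) = (first + A_nI n I)%:E
  /\ first%:E = Vline P [fset Un n a | a in alpha_n n I]%fset
  /\ first%:E = Vunc P n.
Proof.
move=> first; have [nl _] := andP Hl.
have firstE : first = quant_bound l n.
  rewrite /first /quant_bound natrB// !natrX exprS.
  by field; exact: expf_neq0.
have HE := cantor_mean_Rintegral P HP.
have n0 : n%:R != 0 :> R by rewrite pnatr_eq0; lia.
pose al : {fset R * R} := alpha_n n I.
pose be := [fset Un n a | a in al]%fset.
(* Subadditivity is enough, since admissibility asks for at most [n] points. *)
have al_card : (#|` al| <= n)%N.
  have -> : n = (#|~: I| + #|I| + #|I|)%N.
    by rewrite [(#|~: I| + _)%N]addnC cardsC card_tuple card_bool HI subnKC.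
  have imfset_card (f : l.-tuple bool -> R * R) (J : {set l.-tuple bool}) :
      (#|` [fset f s | s in enum J]%fset| <= #|J|)%N.
    rewrite (leq_trans (leq_imfset_card _ _ _))//=.
    by rewrite (leq_trans (size_undup _))// cardE.
  have cardfsU_le (B C : {fset R * R}) : (#|` B `|` C|%fset <= #|` B| + #|` C|)%N.
    by rewrite cardfsU leq_subr.
  apply: leq_trans (cardfsU_le _ _) _; apply: leq_add => //.
  by apply: leq_trans (cardfsU_le _ _) _; apply: leq_add.
have al_cases a : a \in al -> exists w : seq bool, a = Uninv n (aw R w).
  rewrite /al /alpha_n !in_fsetU => /orP[/orP[]|] /imfsetP[s _ ->].
  - by exists s.
  - by exists (rcons s false).
  - by exists (rcons s true).
have al_C w : w \in ~: I -> Uninv n (aw R (val w)) \in al.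
  move=> wI; rewrite /al /alpha_n !in_fsetU; apply/orP; left; apply/orP; left.
  by apply/imfsetP; exists w => //=; rewrite mem_enum.
have al_I w b : w \in I -> Uninv n (aw R (rcons (val w) b)) \in al.
  move=> wI; rewrite /al /alpha_n !in_fsetU; case: b.
    by apply/orP; right; apply/imfsetP; exists w => //=; rewrite mem_enum.
  apply/orP; left; apply/orP; right.
  by apply/imfsetP; exists w => //=; rewrite mem_enum.
have UnK u : Un n (Uninv n u) = u :> R by rewrite /Un /Uninv /=; field.
have al_gt0 : (0 < #|` al|)%N.
  rewrite cardfs_gt0; apply/fset0Pn; pose w : l.-tuple bool := [tuple of nseq l true].
  have [wI|wI] := boolP (w \in I); first by eexists; exact: (al_I _ true wI).
  by exists (Uninv n (aw R (val w))); apply: al_C; rewrite inE.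
have al_Sn : [set` al] `<=` Sj n.
  move=> a /= /al_cases[w ->]; split => //=.
  have : 0 <= aw R w <= 1.
    elim: w => [|b w IHw]; first by rewrite /aw /=; lra.
    have -> : aw R (b :: w) = Tb b (aw R w) by [].
    by case: b => /=; rewrite /T1 /T2; lra.
  have : 0 <= n%:R^-1 :> R by rewrite invr_ge0.
  by move=> ? ?; lra.
have be_card : (0 < #|` be| <= n)%N.
  apply/andP; split; last by apply: leq_trans (leq_imfset_card _ _ _) _; exact: al_card.
  rewrite cardfs_gt0.
  have [a aal] := fset0Pn _ (etrans (esym (cardfs_gt0 al)) al_gt0).
  by apply/fset0Pn; exists (Un n a); exact: in_imfset.
pose E f := (\int[P]_(x in `[0, 1]) f x)%R.
have be_bound : E (mincost sqdist be) <= quant_bound l n.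
  apply: (mincost_cantor_le HE n l I nl HI).
  - by rewrite -size_eq0 -lt0n; case/andP: be_card.
  - by move=> w /al_C wal; rewrite -[aw R _]UnK; exact: in_imfset.
  - by move=> w b /al_I wal; rewrite -[aw R _]UnK; exact: in_imfset.
(* The lower bound, valid at every level, is used at the [l] of the codebook, where it meets the
   upper bound. *)
have be_mean : E (mincost sqdist be) = quant_bound l n.
  apply/eqP; rewrite eq_le be_bound -lee_fin -(Vline_mincost P HP)/=.
    exact: (Vline_ge _ HP).
  by case/andP: be_card.
have al_adm : admissible n al.
  split; last by rewrite al_gt0.
  by move=> a /al_Sn aS; exists n => //=; rewrite leqnn andbT; lia.
(* The second moment contributes another [quant_bound l n], so halving leaves exactly one copy. *)
have boundE : (quant_bound l n + E (fun x => (x + n%:R^-1) ^+ 2)) / 2 =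
    quant_bound l n + A_nI n I.
  have -> : E (fun x => (x + n%:R^-1) ^+ 2) = quant_bound l n + 2 * A_nI n I.
    exact: (cantor_mean_A_nI HE n l I nl HI).
  by lra.
have VqE : Vq P al = (quant_bound l n + A_nI n I)%:E.
  apply/eqP; rewrite eq_le -boundE (Vq_ge _ HP _ _ _ al_adm) andbT.
  by rewrite -be_mean; exact: (Vq_le _ HP).
have VnE : Vn P n = Vq P al.
  apply/eqP; rewrite eq_le; apply/andP; split.
    by apply: ereal_inf_lbound; exists al.
  apply/ereal_infP => _ [al' al'_adm <-]; rewrite VqE -boundE.
  exact: (Vq_ge _ HP).
have VlineE : Vline P be = (quant_bound l n)%:E.
  by rewrite -be_mean; apply: (Vline_mincost P HP); case/andP: be_card.
rewrite firstE; do !split => //.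
apply/eqP; rewrite eq_le; apply/andP; split.
  by apply/ereal_infP => _ [be' be'_card <-]; exact: (Vline_ge _ HP).
by rewrite -VlineE; apply: ereal_inf_lbound; exists be.
Qed.
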